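(* Let $X$ be a countable Ascoli Tychonoff space. Then the free locally convex space $L(X)$ has a $\mathfrak{G}$-base if and only if $X$ has a $\mathfrak{G}$-base.
   Context: $\mathbb{N}^{\mathbb{N}}$ is ordered coordinatewise: $\alpha\le\beta$ iff $\alpha(n)\le\beta(n)$ for all $n\in\mathbb{N}$. $\mathfrak{G}$-base: a topological space $Z$ has a $\mathfrak{G}$-base at $z\in Z$ if it has a base $\{U_\alpha:\alpha\in\mathbb{N}^{\mathbb{N}}\}$ of neighborhoods at $z$ such that $U_\beta\subseteq U_\alpha$ whenever $\alpha\le\beta$; $Z$ has a $\mathfrak{G}$-base if it has one at each of its points. Free locally convex space: $L(X)$ is a (real, Hausdorff) locally convex space together with a continuous map $i:X\to L(X)$ such that for every continuous map $f$ from $X$ to a locally convex space $E$ there is a unique continuous linear operator $\bar f:L(X)\to E$ with $f=\bar f\circ i$. It exists and is unique up to isomorphism. $C_k(X)$ is the space $C(X)$ of all continuous real-valued functions on $X$ with the compact-open topology. $X$ is an Ascoli space if every compact subset $\mathcal{K}$ of $C_k(X)$ is evenly continuous, i.e. the map $\mathcal{K}\times X\to\mathbb{R}$, $(f,x)\mapsto f(x)$, is continuous. *)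

(* Defs.v *)
From HB Require Import structures.
From mathcomp Require Import all_boot all_order all_algebra.
From mathcomp Require Import all_classical all_reals all_analysis.

Set Implicit Arguments.
Unset Strict Implicit.
Unset Printing Implicit Defensive.

Import Order.TTheory GRing.Theory Num.Theory.
Import numFieldNormedType.Exports.

Local Open Scope classical_set_scope.
Local Open Scope ring_scope.

Definition tychonoff_space (X : topologicalType) : Prop :=
  hausdorff_space X /\ completely_regular_space X.

(* The members of the base are neighborhoods of z, not necessarily open. *)
Definition Gbase_at (Z : topologicalType) (z : Z) : Prop :=
  exists U : (nat -> nat) -> set Z,
    [/\ forall a, nbhs z (U a),
        forall V, nbhs z V -> exists a, U a `<=` V
      & forall a b, (forall n, (a n <= b n)%N) -> U b `<=` U a].

Definition has_Gbase (Z : topologicalType) : Prop := forall z : Z, Gbase_at z.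

Section ascoli.
(* This import gives [continuousType X R] the compact-open topology (the
   subspace topology inherited from {compact-open, X -> R}): it is C_k(X). *)
Import ArrowAsCompactOpen.

Definition evenly_continuous (R : realType) (X : topologicalType)
    (K : set (continuousType X R)) : Prop :=
  {within K `*` [set: X], continuous (@eval X R)}.

Definition ascoli_space (R : realType) (X : topologicalType) : Prop :=
  forall K : set (continuousType X R), compact K -> evenly_continuous K.

End ascoli.

(* [tvsType R] is the library's type of locally convex topological vector
   spaces; it does not include the Hausdorff axiom, which is part of the
   convention here both for L and for the test spaces E. The uniformity that a
   [tvsType] carries plays no role: only its topology is used. *)
Definition free_lcs (R : realType) (X : topologicalType) (L : tvsType R)
    (i : X -> L) : Prop :=
  [/\ hausdorff_space L,
      continuous i
    & forall (E : tvsType R) (f : X -> E), hausdorff_space E -> continuous f ->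
        exists g : {linear L -> E},
          [/\ continuous g,
              forall x, f x = g (i x)
            & forall h : {linear L -> E}, continuous h ->
                (forall x, f x = h (i x)) -> h =1 g]].

(* Main.v *)
(* If L has a G-base then so does X, because complete regularity makes i an
   embedding: a separating function X -> R extends to a functional on L.
   Conversely, let T be the span of i(X) with the finest locally convex topology
   making i continuous. The universal property, applied to X -> T, gives a
   continuous section of the inclusion T -> L, so that L = T. Hence a convex
   symmetric W is a neighborhood of 0 in L as soon as it absorbs each i x and
   i y - i x lies in c W, for each c > 0, when y is close enough to x. Such W are
   cofinally described by a scale M(x) and, for each x and n, the index b(x,n) of
   a neighborhood of x on which i y - i x lies in W/(n+1). Since X is countable,
   the data (M, b) are coded by a single element of N^N, monotonically; the convex
   symmetric hulls they generate form a G-base at 0. *)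
From HB Require Import structures.
Require Import Defs.
From mathcomp Require Import all_boot all_order all_algebra.
From mathcomp Require Import all_classical all_reals all_analysis.
From mathcomp Require Import ring lra.

Set Implicit Arguments.
Unset Strict Implicit.
Unset Printing Implicit Defensive.

Import Order.TTheory GRing.Theory Num.Theory.
Import numFieldNormedType.Exports.

Local Open Scope classical_set_scope.
Local Open Scope ring_scope.

(** * Convex symmetric sets *)

Section convex_symmetric.
Context (R : realType) (V : lmodType R).
Implicit Types (A B : set V) (u v : V) (c t : R).

Definition convex_symmetric A :=
  [/\ A 0, forall u, A u -> A (- u)
    & forall t u v, 0 <= t <= 1 -> A u -> A v -> A (t *: u + (1 - t) *: v)].

(** [u + v] is the midpoint of [2 *: u] and [2 *: v]; this plays the part of halving a
    neighborhood. *)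
Lemma convex_symmetric_half A u v : convex_symmetric A ->
  A (2 *: u) -> A (2 *: v) -> A (u + v).
Proof.
case=> _ _ cA Au Av; have := cA 2^-1 _ _ _ Au Av.
rewrite !scalerA (_ : (1 - 2^-1) * 2 = 1) ?mulVf ?scale1r ?pnatr_eq0//; last first.
  by field.
by apply; lra.
Qed.

Lemma convex_symmetric_scale A c u : convex_symmetric A ->
  `|c| <= 1 -> A u -> A (c *: u).
Proof.
case=> _ sA cA; rewrite ler_norml => /andP[c1 c2] Au.
(* [c *: u] is the convex combination of [u] and [- u] with weight [(1 + c) / 2]. *)
have := cA ((1 + c) / 2) _ _ _ Au (sA _ Au).
rewrite scalerN -scalerBl (_ : (1 + c) / 2 - (1 - (1 + c) / 2) = c); last by field.
by apply; lra.
Qed.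

Lemma convex_symmetricI A B : convex_symmetric A -> convex_symmetric B ->
  convex_symmetric (A `&` B).
Proof.
move=> [A0 As Ac] [B0 Bs Bc]; split=> // [u [Au Bu]|t u v t01 [Au Bu] [Av Bv]].
  by split; [exact: As|exact: Bs].
by split; [exact: Ac|exact: Bc].
Qed.

Lemma convex_symmetricZ A c : convex_symmetric A ->
  convex_symmetric [set u | A (c *: u)].
Proof.
move=> [A0 As Ac]; split=> /= [|u|t u v t01 Au Av]; first by rewrite scaler0.
  by rewrite scalerN; exact: As.
by rewrite scalerDr !scalerA !(mulrC c) -!scalerA; exact: Ac.
Qed.

End convex_symmetric.

(** A convex basic open set around 0, intersected with its reflection, is convex and symmetric. *)
Lemma tvs_convex_symmetric (R : realType) (E : tvsType R) (A : set E) :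
  nbhs 0 A -> exists B : set E,
    [/\ nbhs 0 B, convex_symmetric B & B `<=` A].
Proof.
move=> A0; have [F Fcvx [Fop Fb]] := @locally_convex R E.
have [C [FC C0] CA] := Fb 0 A A0.
have nC : nbhs (0 : E) C by apply: open_nbhs_nbhs; split => //; exact: Fop.
have Cc t u v : 0 <= t <= 1 -> C u -> C v -> C (t *: u + (1 - t) *: v).
  move=> /andP[t0 t1] /mem_set Cu /mem_set Cv; apply: set_mem.
  have t01 : Itv.spec (@Itv.num_sem R) (Itv.Real `[0%Z, 1%Z]) t.
    by rewrite /Itv.spec/= /Itv.num_sem/= in_itv/= t0 t1 ger0_real.
  exact: (Fcvx C (mem_set FC) u v (Itv.Def t01) Cu Cv).
exists (C `&` [set u | C (- u)]); split; last by move=> u [/CA].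
- apply: filterI => //; have := nbhs0N nC; apply: filterS => u [v Cv <-] /=.
  by rewrite opprK.
- split=> [|u [? ?]|t u v t01 [Cu Cu'] [Cv Cv']].
  + by split => //=; rewrite oppr0.
  + by split => //=; rewrite opprK.
  + by split; [exact: Cc|rewrite /= opprD -!scalerN; exact: Cc].
Qed.

(** * The span of i(X) as a locally convex space *)

Section linear_span.
Context (R : realType) (X : topologicalType) (L : lmodType R) (i : X -> L).

(** The span as the intersection of all subspaces containing i(X), which is directly an induction
    principle. *)
Definition spanned (v : L) : Prop := forall P : set L,
  P 0 -> (forall (c : R) u w, P u -> P w -> P (c *: u + w)) ->
  (forall x, P (i x)) -> P v.

Definition span_mem : {pred L} := fun v => `[< spanned v >].

Lemma span_memP v : reflect (spanned v) (v \in span_mem).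
Proof. exact: asboolP. Qed.

Lemma span_mem_closed : subsemimod_closed span_mem.
Proof.
split; first split.
- by apply/span_memP => P.
- move=> u v /span_memP Su /span_memP Sv; apply/span_memP => P P0 PD Pi.
  by rewrite -(scale1r u); apply: (PD); [exact: (Su P P0 PD Pi)|exact: (Sv P P0 PD Pi)].
- move=> c u /span_memP Su; apply/span_memP => P P0 PD Pi.
  by rewrite -(addr0 (c *: u)); apply: (PD) => //; exact: (Su P P0 PD Pi).
Qed.

HB.instance Definition _ := GRing.isAddClosed.Build L span_mem
  (proj1 span_mem_closed).
HB.instance Definition _ := GRing.isScaleClosed.Build R L span_mem
  (proj2 span_mem_closed).

Record span_type := SpanType { span_val :> L; span_valP : span_val \in span_mem }.
HB.instance Definition _ := [isSub for span_val].
HB.instance Definition _ := [Choice of span_type by <:].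
HB.instance Definition _ := [SubChoice_isSubLmodule of span_type by <:].

Lemma span_mem_gen x : i x \in span_mem.
Proof. by apply/span_memP => P _ _; exact. Qed.

Definition span_gen (x : X) : span_type := SpanType (span_mem_gen x).


(* These sets are the basic neighborhoods of 0 for the finest locally convex
   topology on the span of i(X) making i continuous. *)
Definition gen_nbhs (W : set L) : Prop :=
  [/\ convex_symmetric W,
      forall x, exists2 c : R, 0 < c & W (c *: i x)
    & forall x (c : R), \forall y \near x, W (c *: (i y - i x))].

Lemma gen_nbhsT : gen_nbhs setT.
Proof.
by split=> //= x; [exists 1|move=> c; near=> y].
Unshelve. all: by end_near. Qed.

Lemma gen_nbhsI A B : gen_nbhs A -> gen_nbhs B -> gen_nbhs (A `&` B).
Proof.
move=> [cA aA gA] [cB aB gB]; split; first exact: convex_symmetricI.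
- move=> x; have [a a0 Aa] := aA x; have [b b0 Bb] := aB x.
  exists (Num.min a b); first by rewrite lt_min a0.
  have le1 (d e : R) : 0 < d -> 0 < e -> `|Num.min d e / d| <= 1.
    move=> d0 e0; rewrite ger0_norm ?ler_pdivrMr ?mul1r ?ge_min ?lexx//.
    by rewrite divr_ge0 ?le_min ?ltW.
  split.
  + have := convex_symmetric_scale cA (le1 _ _ a0 b0) Aa.
    by rewrite scalerA divfK ?gt_eqF.
  + have := convex_symmetric_scale cB (le1 _ _ b0 a0) Bb.
    by rewrite scalerA divfK ?gt_eqF// minC.
- by move=> x c; apply: filterI; [exact: gA|exact: gB].
Qed.

Lemma gen_nbhsZ A (c : R) : 0 < c -> gen_nbhs A -> gen_nbhs [set u | A (c *: u)].
Proof.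
move=> c0 [cA aA gA]; split; first exact: convex_symmetricZ.
- move=> x; have [a a0 Aa] := aA x; exists (a / c); first exact: divr_gt0.
  by rewrite /= scalerA mulrC divfK ?gt_eqF.
- by move=> x d; apply: filterS (gA x (c * d)) => y /=; rewrite scalerA.
Qed.

(** The vectors absorbed by [A] form a linear subspace containing each [i x]. *)
Lemma gen_nbhs_absorb A v : gen_nbhs A -> spanned v ->
  exists2 e : R, 0 < e & forall t : R, `|t| <= e -> A (t *: v).
Proof.
move=> [cA aA gA].
have small (e : R) u : 0 < e -> A (e *: u) -> forall t : R, `|t| <= e -> A (t *: u).
  move=> e0 Au t te; rewrite -(divfK (lt0r_neq0 e0) t) -scalerA.
  apply: convex_symmetric_scale Au => //.
  by rewrite normrM normfV (gtr0_norm e0) ler_pdivrMr ?mul1r.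
move=> /(_ [set v | exists2 e : R, 0 < e & forall t : R, `|t| <= e -> A (t *: v)]).
apply; first by exists 1 => // t _; rewrite scaler0; case: cA.
- move=> c u w [e e0 Ae] [d d0 Ad].
  (* Chosen so that [2 * m * |c| <= e] and [2 * m <= d]; the [+ 1] covers [c = 0]. *)
  pose m : R := Num.min (e / (`|c| + 1)) d / 2.
  have c1 : 0 < `|c| + 1 by rewrite ltr_wpDl.
  have m0 : 0 < m by rewrite divr_gt0 // lt_min d0 divr_gt0.
  have m2 : 2 * m = Num.min (e / (`|c| + 1)) d.
    by rewrite mulrC divfK// pnatr_eq0.
  have min0 : 0 <= 2 * m by rewrite mulr_ge0// ltW.
  exists m => //; apply: small => //; rewrite scalerDr.
  apply: convex_symmetric_half => //; rewrite scalerA.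
    rewrite scalerA; apply: Ae; rewrite mulrA normrM ger0_norm// m2.
    rewrite (@le_trans _ _ (e / (`|c| + 1) * `|c|))//.
      by rewrite ler_wpM2r// ge_min lexx.
    by rewrite mulrAC ler_pdivrMr// ler_wpM2l ?ltW// ltrDl.
  by apply: Ad; rewrite ger0_norm// m2 ge_min lexx orbT.
- by move=> x; have [a a0 Aa] := aA x; exists a => //; exact: small.
Qed.

Definition span_nbhs (x : span_type) : set_system span_type :=
  [set A | exists2 W : set L, gen_nbhs W &
    forall v : span_type, W (val v) -> A (x + v)].

HB.instance Definition _ := hasNbhs.Build span_type span_nbhs.

Lemma span_nbhs_proper (p : span_type) : ProperFilter (span_nbhs p).
Proof.
apply: Build_ProperFilter_ex.
  by move=> A [W [[W0 _ _] _ _] WA]; exists (p + 0); exact: WA.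
split; first by exists setT => //; exact: gen_nbhsT.
- move=> A B [V gV VA] [W gW WB]; exists (V `&` W); first exact: gen_nbhsI.
  by move=> v [/VA ? /WB].
- by move=> A B AB [V gV VA]; exists V => // v /VA /AB.
Qed.

Lemma span_nbhs_singleton (p : span_type) (A : set span_type) :
  span_nbhs p A -> A p.
Proof.
by move=> [W [[W0 _ _] _ _] WA]; rewrite -(addr0 p); exact: WA.
Qed.

Lemma span_nbhs_nbhs (p : span_type) (A : set span_type) :
  span_nbhs p A -> span_nbhs p (span_nbhs^~ A).
Proof.
move=> [W gW WA]; exists [set u | W (2 *: u)]; first exact: gen_nbhsZ.
move=> v /= Wv; exists [set u | W (2 *: u)]; first exact: gen_nbhsZ.
move=> u /= Wu; rewrite -addrA; apply: WA.
by apply: convex_symmetric_half; case: gW.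
Qed.

HB.instance Definition _ := Nbhs_isNbhsTopological.Build span_type
  span_nbhs_proper span_nbhs_singleton span_nbhs_nbhs.

Lemma span_add_continuous :
  continuous (fun x : span_type * span_type => x.1 + x.2).
Proof.
move=> [x y] A [W gW WA].
exists ([set x + v | v in [set v | W (2 *: val v)]],
        [set y + v | v in [set v | W (2 *: val v)]]) => /=.
  by split; exists [set u | W (2 *: u)] => /=;
    [exact: gen_nbhsZ|move=> v Wv; exists v|exact: gen_nbhsZ|move=> v Wv; exists v].
move=> _ /= [[u Wu <-] [v Wv <-]]; rewrite addrACA; apply: WA.
by apply: convex_symmetric_half; case: gW.
Qed.

Lemma span_scale_continuous :
  continuous (fun z : R^o * span_type => z.1 *: z.2).
Proof.
move=> [c x] A [W gW WA].
have [e e0 We] := gen_nbhs_absorb gW (elimT (span_memP _) (valP x)).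
have c1 : 0 < 2 * (`|c| + 1) by rewrite mulr_gt0 // ltr_wpDl.
have cW : convex_symmetric W by case: gW.
(* Write [d *: (x + v)] as [c *: x + ((d - c) *: x + d *: v)]. The bound [e / 2] controls the first
   error through absorption of [x]; the bound 1 gives [|d| <= |c| + 1], which controls the
   second. *)
exists ([set d : R^o | `|d - c| <= Num.min 1 (e / 2)],
        [set x + v | v in [set v | W ((2 * (`|c| + 1)) *: val v)]]) => /=.
  split; last first.
    exists [set u | W ((2 * (`|c| + 1)) *: u)]; first exact: gen_nbhsZ.
    by move=> v Wv; exists v.
  apply/nbhs_ballP; exists (Num.min 1 (e / 2)) => /=.
    by rewrite lt_min ltr01 divr_gt0.
  by move=> d; rewrite -ball_normE/= distrC => /ltW.
move=> [d _] /= [dc [v Wv <-]].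
rewrite (_ : d *: (x + v) = c *: x + ((d - c) *: x + d *: v)); last first.
  by rewrite addrA -scalerDl (addrC c) subrK scalerDr.
apply: WA; apply: convex_symmetric_half => //=; rewrite scalerA.
  apply: We; rewrite normrM ger0_norm// mulrC -ler_pdivlMr//.
  by rewrite (le_trans dc)// ge_min lexx orbT.
rewrite (_ : 2 * d = (d / (`|c| + 1)) * (2 * (`|c| + 1))); last first.
  by rewrite mulrCA divfK // gt_eqF // ltr_wpDl.
rewrite -scalerA; apply: convex_symmetric_scale => //.
rewrite normrM normfV [X in _ / X]ger0_norm ?addr_ge0//.
rewrite ler_pdivrMr ?ltr_wpDl// mul1r -(subrK c d) addrC.
rewrite (le_trans (ler_normD _ _))// lerD2l (le_trans dc)//.
by rewrite ge_min lexx.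
Qed.

Lemma span_locally_convex :
  exists2 B : set_system span_type, (forall b, b \in B -> convex_set b) & basis B.
Proof.
exists [set b : set span_type | open b /\
  forall t u v, 0 <= t <= 1 -> b u -> b v -> b (t *: u + (1 - t) *: v)].
  move=> b /set_mem[_ bc] u v l /set_mem bu /set_mem bv; apply/mem_set.
  by apply: bc => //; rewrite ge0 le1.
split; first by move=> b [].
move=> x A [W gW WA].
(* The interior of [x + W] is open by construction and inherits convexity from [W]. *)
pose b := [set u : span_type | W (val (u - x))]^°.
exists b; last first.
  move=> u /interior_subset /= Wu; rewrite -(subrK x u) addrC; exact: WA.
split; last by exists W => // v; rewrite /= addrAC subrr add0r.
split; first exact: open_interior.
move=> t u v t01 [U gU UW] [V gV VW].
(* If [u + U] and [v + V] lie in [x + W], so does the convex combination of [u] and [v] translated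
   by [w] in both [U] and [V], as [w = t *: w + (1 - t) *: w]. *)
exists (U `&` V); first exact: gen_nbhsI.
move=> w [/UW /= Uw /VW /= Vw].
have [[_ _ Wc] _ _] := gW.
have := Wc t _ _ t01 Uw Vw.
rewrite -!addrA (scalerDr t) (scalerDr (1 - t)) addrACA.
by rewrite -scalerDl (addrC t) subrK scale1r addrA.
Qed.

(* The factory PreTopologicalLmod_isTvs only declares the uniformity, so the
   remaining mixins of a tvs are declared by hand. *)
HB.instance Definition _ := PreTopologicalLmod_isTvs.Build R span_type
  span_add_continuous span_scale_continuous span_locally_convex.
HB.instance Definition _ := PreTopologicalNmodule_isTopologicalNmodule.Build
  span_type span_add_continuous.
HB.instance Definition _ := TopologicalNmodule_isTopologicalLmodule.Build
  R span_type span_scale_continuous.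
HB.instance Definition _ := Uniform_isTvs.Build R span_type span_locally_convex.

Lemma span_gen_continuous : continuous span_gen.
Proof.
move=> x A [W [cW aW gW] WA]; apply: filterS (gW x 1) => y /= Wy.
rewrite -(subrK (span_gen x) (span_gen y)) addrC; apply: WA => /=.
by rewrite -(scale1r (i y - i x)).
Qed.

End linear_span.

(** * Neighborhoods of 0 in the free locally convex space *)

Section free_locally_convex.
Context (R : realType) (X : topologicalType) (L : tvsType R) (i : X -> L)
  (i_cont : continuous i).

(** Absorption is continuity of scaling at [(0, i x)]; the last condition holds because
    [c *: (i y - i x)] is continuous in [y] and vanishes at [x]. *)
Lemma gen_nbhs_nbhs0 (W : set L) : convex_symmetric W -> nbhs 0 W -> gen_nbhs i W.
Proof.
move=> cW nW; split => // [x|x c].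
- have := @scale_continuous R L (0, i x) W; rewrite scale0r => /(_ nW).
  move=> [[/= A B] /= [/nbhs_ballP[e /= e0 eA] Bx] AB].
  exists (e / 2); first exact: divr_gt0.
  apply: (AB (e / 2, i x)); split; last exact: nbhs_singleton.
  apply: eA; rewrite -ball_normE/= sub0r normrN gtr0_norm ?divr_gt0//.
  by rewrite ltr_pdivrMr// ltr_pMr// ltr1n.
- have : continuous (fun y => c *: (i y - i x)).
    move=> y; apply: (@continuous_comp _ (R^o * L)%type _
      (fun y => (c, i y - i x)) (fun z => z.1 *: z.2)); last exact: scale_continuous.
    apply: (@cvg_pair _ _ _ _ (nbhs (c : R^o))) => /=; first exact: cvg_cst.
    by apply: (@continuous_comp _ (L * L)%type _ (fun y => (i y, i x))
      (fun z => z.1 - z.2)); [apply: cvg_pair => /=; [exact: i_cont|exact: cvg_cst]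
      |exact: sub_continuous].
  by move=> /(_ x W) /=; rewrite subrr scaler0; apply.
Qed.

Lemma span_val_continuous : continuous (@span_val R X L i).
Proof.
move=> p A pA.
have A0 : nbhs 0 [set v | A (val p + v)].
  have := nbhsB (- val p) pA; rewrite addNr; apply: filterS => _ [v Av <-] /=.
  by rewrite addrA subrr add0r.
have [W [W0 cW WA]] := tvs_convex_symmetric A0.
exists W; first exact: gen_nbhs_nbhs0.
by move=> v /WA.
Qed.

(** The inclusion into [L] is continuous and injective. The universal property can then be applied
    to the span. *)
Lemma span_hausdorff : hausdorff_space L -> hausdorff_space (span_type i).
Proof.
move=> hL p q pq; apply/val_inj/hL => A B pA qB.
have [r [rA rB]] := pq _ _ (span_val_continuous pA) (span_val_continuous qB).
by exists (val r).
Qed.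

Lemma free_lcs_gen_nbhs (W : set L) : free_lcs i -> gen_nbhs i W -> nbhs 0 W.
Proof.
move=> [hL _ univ] gW.
have [g [gc gi _]] := univ (span_type i) (span_gen i) (span_hausdorff hL)
  (@span_gen_continuous _ _ _ i).
have [h [_ _ huniq]] := univ _ i hL i_cont.
(* Both [val \o g] and the identity extend [i], so both equal the unique extension [h]. *)
have vg v : val (g v) = v.
  have -> : val (g v) = h v.
    apply: (huniq (\val \o g : {linear L -> L})).
      by move=> u; apply: continuous_comp; [exact: gc|exact: span_val_continuous].
    by move=> x /=; rewrite -gi.
  symmetry; by apply: (huniq (idfun : {linear L -> L})) => // u; exact: cvg_id.
have : nbhs (g 0) [set p | W (val p)].
  by rewrite linear0; exists W => // v; rewrite /= add0r.
move=> /(gc 0 _) => W0.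
have {}W0 : nbhs 0 (g @^-1` [set p | W (val p)]) by exact: W0.
by apply: filterS W0 => v /=; rewrite vg.
Qed.


(** * Transfer of bases between X and L *)

Lemma free_lcs_inducing (x : X) (V : set X) : free_lcs i ->
  completely_regular_space X -> nbhs x V ->
  exists2 W, nbhs (i x) W & i @^-1` W `<=` V.
Proof.
move=> [_ _ univ] crX; rewrite nbhsE => -[D [oD Dx] DV].
have /(@uniform_separatorP _ R)[f [cf _ f0 f1]] :=
  crX x (~` D) (open_closedC oD) (fun nDx => nDx Dx).
have [g [gc fE _]] := univ R^o f (@Rhausdorff R) cf.
exists [set v | g v < 1].
  have fx : f x = 0 by apply: f0; exists x.
  by apply: (gc (i x) [set r : R^o | r < 1]); rewrite -fE fx; exact: lt_nbhsl.
move=> y /=; rewrite -fE => fy; apply: DV; apply: contrapT => Dy.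
have fy1 : f y = 1 by apply: f1; exists y.
by rewrite fy1 ltxx in fy.
Qed.

Lemma free_lcs_Gbase_gen : free_lcs i -> completely_regular_space X ->
  has_Gbase L -> has_Gbase X.
Proof.
move=> fL crX gL x; have [U [Ux Ub Umono]] := gL (i x).
exists (fun a => i @^-1` U a); split=> [a|V Vx|a b ab y].
- exact: (i_cont (Ux a)).
- have [W /Ub[a aW] WV] := free_lcs_inducing fL crX Vx.
  by exists a; apply: subset_trans WV => y /aW.
- exact: Umono.
Qed.

(* [block e a x 0 0] codes the scale at x and [block e a x n.+1] the index of
   the neighborhood of x at precision n. *)
Definition block (e : X -> nat) (a : nat -> nat) (x : X) (n : nat) : nat -> nat :=
  fun k => a (pickle (e x, n, k)).

Lemma block_surj (e : X -> nat) (F : X -> nat -> nat -> nat) :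
  injective e -> exists a, forall x n, block e a x n = F x n.
Proof.
move=> inj_e.
have /choice[a aE] : forall m, exists r : nat,
    forall x n k, m = pickle (e x, n, k) -> r = F x n k.
  move=> m.
  have [[x [n [k mE]]]|no] :=
    pselect (exists (x : X) (n k : nat), m = pickle (e x, n, k)).
    exists (F x n k) => x' n' k'; rewrite mE.
    by move=> /(pcan_inj pickleK) /= [] /inj_e -> -> ->.
  (* Default value at numbers that code no triple. *)
  by exists 0%N => x n k mE; exfalso; apply: no; exists x, n, k.
by exists a => x n; apply/funext => k; exact: aE.
Qed.

(** The smallest convex symmetric set containing the scaled generators and the differences
    prescribed by [a]. *)
Definition gen_hull (e : X -> nat) (U : X -> (nat -> nat) -> set X) a : set L :=
  [set v | forall B : set L, convex_symmetric B ->
    (forall x, B ((block e a x 0 0).+1%:R^-1 *: i x)) ->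
    (forall x n y, U x (block e a x n.+1) y -> B (n.+1%:R *: (i y - i x))) ->
    B v].

Lemma gen_hull_gen_nbhs e U a : (forall x b, nbhs x (U x b)) ->
  gen_nbhs i (gen_hull e U a).
Proof.
move=> Un.
have cH : convex_symmetric (gen_hull e U a).
  split=> [B [] //|u Hu B cB B1 B2|t u v t01 Hu Hv B cB B1 B2].
    by have [_ sB _] := cB; apply: sB; exact: Hu.
  by have [_ _ ccB] := cB; apply: ccB => //; [exact: Hu|exact: Hv].
split=> // [x|x c].
  by exists (block e a x 0 0).+1%:R^-1; [rewrite invr_gt0|move=> B cB B1 B2; exact: B1].
(* Integer precisions suffice: a real factor [c] is dominated by some [n.+1]. *)
have [n nc] : exists n, `|c| <= n.+1%:R.
  by exists (Num.trunc `|c|); exact/ltW/truncnS_gt.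
apply: filterS (Un x (block e a x n.+1)) => y Uy.
rewrite -(divfK (_ : n.+1%:R != 0) c) ?pnatr_eq0// -scalerA.
apply: (convex_symmetric_scale cH).
  by rewrite normrM normfV normr_nat ler_pdivrMr ?mul1r.
by move=> B cB B1 B2; exact: B2.
Qed.

Lemma Gbase0_has_Gbase : Gbase_at (0 : L) -> has_Gbase L.
Proof.
move=> [U [U0 Ub Umono]] z.
exists (fun a => [set z + v | v in U a]); split=> [a|V Vz|a b ab].
- exact: nbhsT.
- have := nbhsB (- z) Vz; rewrite addNr => /Ub[a aV]; exists a.
  by move=> _ [v /aV[w Vw <-] <-]; rewrite addrA subrr add0r.
- exact/image_subset/Umono.
Qed.

Lemma Gbase_free_lcs : free_lcs i -> countable [set: X] ->
  has_Gbase X -> has_Gbase L.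
Proof.
move=> fL /countable_injP[e inj_e] /choice[U UP]; apply: Gbase0_has_Gbase.
have Un x b : nbhs x (U x b) by have [] := UP x.
have {}inj_e : injective e by move=> x y; apply: inj_e; rewrite inE.
exists (gen_hull e U); split=> [a|V V0|a b ab v Hv B cB B1 B2].
- exact/free_lcs_gen_nbhs/gen_hull_gen_nbhs.
- have [B [B0 cB BV]] := tvs_convex_symmetric V0.
  have [_ aB gB] := gen_nbhs_nbhs0 cB B0.
  have /choice[M MP] : forall x, exists m, B (m.+1%:R^-1 *: i x).
    move=> x; have [c c0 Bc] := aB x.
    (* Truncation gives [c^-1 < m.+1], hence [m.+1%:R^-1 < c]. *)
    exists (Num.trunc c^-1).
    rewrite -(divfK (lt0r_neq0 c0) _^-1) -scalerA.
    apply: (convex_symmetric_scale cB _) => //.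
    rewrite ger0_norm ?mulr_ge0 ?invr_ge0 ?(ltW c0)//.
    by rewrite mulrC ler_pdivrMr ?mul1r//; exact/ltW/truncnS_gt.
  have /choice[F FP] : forall xn : X * nat, exists b,
      U xn.1 b `<=` [set y | B (xn.2.+1%:R *: (i y - i xn.1))].
    by move=> [x n] /=; have [_ Ub _] := UP x; apply: Ub; exact: gB.
  (* With this [a], [B] itself is one of the sets intersected in the hull, so the hull lies in
     [B]. *)
  have [a aE] := @block_surj e
    (fun x n => if n is n'.+1 then F (x, n') else fun=> M x) inj_e.
  exists a => v Hv; apply/BV/(Hv B cB) => [x|x n y]; first by rewrite aE.
  by rewrite aE; exact: (FP (x, n)).
(* Passing from [a] to a larger [b] shortens the multiples of [i x] and shrinks the neighborhoods,
   so a [B] admissible for [a] is admissible for [b]. *)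
- apply: (Hv B cB) => [x|x n y Uy].
    rewrite -(divfK (_ : (block e a x 0 0).+1%:R^-1 != 0) (block e b x 0 0).+1%:R^-1).
      rewrite -scalerA; apply: (convex_symmetric_scale cB _) => //.
      rewrite invrK ger0_norm ?mulr_ge0// mulrC ler_pdivrMr// mul1r ler_nat ltnS.
      exact: ab.
    by rewrite invr_eq0 pnatr_eq0.
  by apply: B2; have [_ _ Umono] := UP x; apply: Umono Uy => k; exact: ab.
Qed.

End free_locally_convex.

Theorem corollary1p9 (R : realType) (X : topologicalType)
    (X_countable : countable [set: X]) (X_tychonoff : tychonoff_space X)
    (X_ascoli : ascoli_space R X)
    (L : tvsType R) (i : X -> L) (L_free : free_lcs i) :
  has_Gbase L <-> has_Gbase X.
Proof.
have [_ i_cont _] := L_free; have [_ crX] := X_tychonoff.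
by split; [exact: free_lcs_Gbase_gen|exact: Gbase_free_lcs].
Qed.
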